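(* Consider deterministic OGDA or deterministic EG run for $T$ iterations on $\min_x\max_{y\in\mathcal{Y}}f(x,y)$ with step sizes $\eta_x=c_1\min\left\{\frac{\epsilon}{\ell G},\frac{\epsilon^2}{\ell G^2},\frac{\epsilon^4}{D^2G^2\ell^3}\right\}$ and $\eta_y=\frac1{2\ell}$, where $c_1>0$ is a fixed numerical constant, and let $x_T$ be the returned solution. There is a constant $c>0$ depending only on $c_1$ such that for all $\ell,G,D,\Delta>0$ and all sufficiently small $\epsilon>0$ there exist a bounded convex set $\mathcal{Y}$ of diameter $D$, a function $f:\mathbb{R}\times\mathcal{Y}\to\mathbb{R}$ that is $G$-Lipschitz in $x$, $\ell$-gradient Lipschitz (i.e. $\ell$-smooth) and concave in $y$, and an initialization $(x_0,y_0)$ with $\hat\Delta_\Phi=\Delta$, such that, for each of the two methods, $\|\nabla\Phi_{1/2\ell}(x_T)\|\le\epsilon$ implies $$T\ \ge\ c\,\frac{\ell^3G^2D^2\hat\Delta_\Phi}{\epsilon^6}.$$ (That is, OGDA/EG requires $T=\Omega(\ell^3G^2D^2\hat\Delta_\Phi/\epsilon^6)$ iterations.)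
   Context: $f$ is $\ell$-smooth if it is differentiable and $\|\nabla f(x_1,y_1)-\nabla f(x_2,y_2)\|^2\le \ell^2\|x_1-x_2\|^2+\ell^2\|y_1-y_2\|^2$. $\Phi(x)=\max_{y\in\mathcal{Y}}f(x,y)$; its Moreau envelope is $\Phi_{1/2\ell}(x)=\min_{x'}\{\Phi(x')+\ell\|x'-x\|^2\}$; $\hat\Delta_\Phi=\Phi_{1/2\ell}(x_0)-\min_x\Phi_{1/2\ell}(x)$. $\mathcal{P}_{\mathcal{Y}}$ is Euclidean projection onto $\mathcal{Y}$. OGDA (with $(x_{-1},y_{-1})=(x_0,y_0)$), $t\ge0$: $x_{t+1}=x_t-\eta_x\nabla_xf(x_t,y_t)-\eta_x(\nabla_xf(x_t,y_t)-\nabla_xf(x_{t-1},y_{t-1}))$, $y_{t+1}=\mathcal{P}_{\mathcal{Y}}\big(y_t+\eta_y\nabla_yf(x_t,y_t)+\eta_y(\nabla_yf(x_t,y_t)-\nabla_yf(x_{t-1},y_{t-1}))\big)$. EG, $t\ge0$: $x_{t+1/2}=x_t-\eta_x\nabla_xf(x_t,y_t)$, $y_{t+1/2}=\mathcal{P}_{\mathcal{Y}}(y_t+\eta_y\nabla_yf(x_t,y_t))$, $x_{t+1}=x_t-\eta_x\nabla_xf(x_{t+1/2},y_{t+1/2})$, $y_{t+1}=\mathcal{P}_{\mathcal{Y}}(y_t+\eta_y\nabla_yf(x_{t+1/2},y_{t+1/2}))$. *)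

(* Defs.v *)
From HB Require Import structures.
From mathcomp Require Export all_boot all_order all_algebra.
From mathcomp Require Export all_classical all_reals all_analysis.

Set Implicit Arguments.
Unset Strict Implicit.
Unset Printing Implicit Defensive.

Import Order.TTheory GRing.Theory Num.Theory.
Export numFieldNormedType.Exports.

Local Open Scope classical_set_scope.
Local Open Scope ring_scope.

Section Euclidean.
Context {R : realType} {n : nat}.
Implicit Types (Y : set 'rV[R]_n) (u p : 'rV[R]_n).

(* The library norm on ['rV_n] is the sup norm. *)
Definition euclid_norm u : R := Num.sqrt (\sum_(i < n) u ord0 i ^+ 2).

(* This is the diameter only for bounded nonempty [Y]: [sup] is 0 otherwise. *)
Definition diameter Y : R :=
  sup [set euclid_norm (z.1 - z.2) | z in Y `*` Y].

Definition is_proj Y u p :=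
  Y p /\ forall q, Y q -> euclid_norm (u - p) <= euclid_norm (u - q).

(* Well defined for closed convex nonempty [Y]. *)
Definition proj Y u : 'rV[R]_n := xget 0 [set p | is_proj Y u p].

End Euclidean.

Section Objective.
Context {R : realType} {n : nat}.
Implicit Types (Y : set 'rV[R]_n) (f : R -> 'rV[R]_n -> R).

(* A function on [R x Y] is represented by a total function; only its values
   and its derivatives at points of [R x Y] are constrained or used. *)

Definition grad_x f (x : R) (y : 'rV[R]_n) : R :=
  derive1 (fun x' : R^o => f x' y : R^o) x.

Definition grad_y f (x : R) (y : 'rV[R]_n) : 'rV[R]_n :=
  \row_(i < n) 'D_(delta_mx ord0 i) (f x : 'rV[R]_n -> R^o) y.

Definition smooth_on (l : R) Y f :=
  (forall x y, Y y ->
     differentiable (fun z : R^o * 'rV[R]_n => f z.1 z.2 : R^o) (x, y)) /\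
  (forall x1 x2 y1 y2, Y y1 -> Y y2 ->
     (grad_x f x1 y1 - grad_x f x2 y2) ^+ 2 +
     euclid_norm (grad_y f x1 y1 - grad_y f x2 y2) ^+ 2
     <= l ^+ 2 * (x1 - x2) ^+ 2 + l ^+ 2 * euclid_norm (y1 - y2) ^+ 2).

Definition lipschitz_in_x (G : R) Y f :=
  forall y, Y y -> G.-lipschitz (fun x : R^o => f x y : R^o).

Definition concave_in_y Y f :=
  forall x, convex_function Y (fun y => - f x y).

End Objective.

Section Moreau.
Context {R : realType}.

Definition is_max (A : set R) (m : R) := A m /\ ubound A m.
Definition is_min (A : set R) (m : R) := A m /\ lbound A m.

Definition is_primal {n : nat} (Y : set 'rV[R]_n) (f : R -> 'rV[R]_n -> R)
    (Phi : R -> R) :=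
  forall x, is_max (f x @` Y) (Phi x).

(* [env] is the Moreau envelope [Phi_{1/2l}]. *)
Definition is_moreau (l : R) (Phi env : R -> R) :=
  forall x, is_min (range (fun x' => Phi x' + l * `|x' - x| ^+ 2)) (env x).

(* The minimum of [env] has to be attained for the gap to be defined. *)
Definition is_gap (env : R -> R) (x0 gap : R) :=
  exists2 m, is_min (range env) m & gap = env x0 - m.

End Moreau.

Section Algorithms.
Context {R : realType} {n : nat}.
Variables (Y : set 'rV[R]_n) (f : R -> 'rV[R]_n -> R) (eta_x eta_y : R).

Local Notation point := (R * 'rV[R]_n)%type.
Local Notation gx z := (grad_x f z.1 z.2).
Local Notation gy z := (grad_y f z.1 z.2).

(* The state is the pair (previous iterate, current iterate). *)
Definition ogda_step (s : point * point) : point * point :=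
  let: (zp, z) := s in
  (z, (z.1 - eta_x * gx z - eta_x * (gx z - gx zp),
       proj Y (z.2 + eta_y *: gy z + eta_y *: (gy z - gy zp)))).

Definition ogda (z0 : point) (t : nat) : point :=
  (iter t ogda_step (z0, z0)).2.

Definition eg_step (z : point) : point :=
  let w := (z.1 - eta_x * gx z, proj Y (z.2 + eta_y *: gy z)) in
  (z.1 - eta_x * gx w, proj Y (z.2 + eta_y *: gy w)).

Definition eg (z0 : point) (t : nat) : point := iter t eg_step z0.

End Algorithms.

Definition step_x {R : realType} (c1 l G D eps : R) : R :=
  c1 * Num.min (eps / (l * G))
         (Num.min (eps ^+ 2 / (l * G ^+ 2))
                  (eps ^+ 4 / (D ^+ 2 * G ^+ 2 * l ^+ 3))).

Definition step_y {R : realType} (l : R) : R := (2 * l)^-1.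

(* Main.v *)
(* The hard instance does not depend on [y]: [f (x, y)] is the Huber function of
   curvature [l] and slope [s = 2 eps], and [Y] is the segment [[0, D]].  The
   Moreau envelope is again a Huber function, of curvature [2 l / 3] and slope
   [s], so its gradient exceeds [eps] until the iterate has crossed the linear
   part, of length [Delta / s].  Since [|f'| <= s], one iteration moves [x] by
   at most [3 s eta_x], whence [T >= Delta / (3 s^2 eta_x)], and
   [eta_x <= c1 eps^4 / (D^2 G^2 l^3)]. *)

Require Import Defs.
From mathcomp Require Import all_boot all_order all_algebra.
From mathcomp Require Import all_classical all_reals all_analysis.
From mathcomp Require Import ring lra.
Import Order.TTheory GRing.Theory Num.Theory.
Import numFieldNormedType.Exports.
Local Open Scope classical_set_scope.
Local Open Scope ring_scope.

Set Implicit Arguments.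
Unset Strict Implicit.

(** The difference quotient is within [K * |h|] of [d]. With this criterion the Huber function is
    differentiated at its kinks without a case analysis. *)
Lemma is_derive1_quadratic_remainder (R : realType) (F : R^o -> R^o)
    (x d K : R) :
  (forall y, `|F y - F x - d * (y - x)| <= K * (y - x) ^+ 2) ->
  is_derive (x : R^o) (1 : R^o) F d.
Proof.
move=> FK.
have lim_d : h^-1 *: ((F \o shift x) (h *: (1 : R^o)) - F x) @[h --> 0^'] --> d.
  apply/cvgrPdist_le => e e0; near=> h.
  have h0 : h != 0 by near: h; exact: nbhs_dnbhs_neq.
  (* The added 1 keeps the denominator positive even when [K = 0]. *)
  have K1 : 0 < `|K| + 1 by rewrite ltr_wpDl.
  have hle : `|h| <= e / (`|K| + 1).
    near: h; apply: dnbhs0_le; exact: divr_gt0.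
  have /= := FK (h + x); rewrite addrK => FKh.
  rewrite /= /GRing.scale /= mulr1 distrC.
  rewrite -[X in _ - X](mulKf h0) -mulrBr normrM normfV (mulrC h).
  rewrite ler_pdivrMl ?normr_gt0//.
  apply: le_trans FKh _.
  rewrite -[h ^+ 2]real_normK ?num_real // expr2 mulrCA ler_wpM2l //.
  apply: le_trans (_ : `|K| * `|h| <= _); first by rewrite ler_wpM2r // ler_norm.
  move: hle; rewrite ler_pdivlMr // mulrDr mulr1 mulrC; apply: le_trans.
  by rewrite lerDl.
by apply: DeriveDef; [apply/cvg_ex; exists d | exact: cvg_lim].
Unshelve. all: by end_near. Qed.

(** * The Huber function: derivative, Moreau envelope and gap *)

Section Huber.
Context {R : realType}.
Implicit Types k l s x p : R.

Definition clamp k s x := Num.max (- s) (Num.min s (k * x)).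

(* The conjugate of [p^2 / (2 k)] on [[- s, s]]: the supremum of
   [p x - p^2 / (2 k)] is attained at [p = clamp k s x]. *)
Definition huber k s x := clamp k s x * x - clamp k s x ^+ 2 / (2 * k).

Lemma clampP k s x : 0 < s ->
  [\/ clamp k s x = - s /\ k * x <= - s,
      clamp k s x = k * x /\ - s <= k * x <= s |
      clamp k s x = s /\ s <= k * x].
Proof.
rewrite /clamp => s0; case: (leP s (k * x)) => h1.
  by constructor 3; split=> //; rewrite max_r //; lra.
case: (leP (- s) (k * x)) => h2; [constructor 2 | constructor 1]; split=> //; lra.
Qed.

Lemma norm_clamp_le k s x : 0 < s -> `|clamp k s x| <= s.
Proof.
by move=> s0; rewrite ler_norml; case: (clampP k x s0) => -[-> h]; lra.
Qed.

Lemma clamp_lipschitz k s x y : 0 < k -> 0 < s ->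
  `|clamp k s x - clamp k s y| <= k * `|x - y|.
Proof.
move=> k0 s0; rewrite -[k in k * _]gtr0_norm // -normrM mulrBr.
have h1 := ler_norm (k * x - k * y).
have := ler_norm (k * y - k * x); rewrite distrC => h2.
rewrite ler_norml.
by case: (clampP k x s0) => -[-> ?]; case: (clampP k y s0) => -[-> ?]; lra.
Qed.

(** Fenchel-Young inequality. Since [2kx - g - p = 2(kx - g) + (g - p)], it reduces to the sign of
    [(g - p)(kx - g)]. *)
Lemma huber_ge k s x p : 0 < k -> 0 < s -> `|p| <= s ->
  p * x - p ^+ 2 / (2 * k) <= huber k s x.
Proof.
move=> k0 s0; rewrite ler_norml => /andP[p1 p2]; rewrite /huber -subr_ge0.
set g := clamp k s x.
have -> : g * x - g ^+ 2 / (2 * k) - (p * x - p ^+ 2 / (2 * k)) =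
  (g - p) * (2 * (k * x) - g - p) / (2 * k) by field; lra.
apply: divr_ge0; last lra.
(* Variational inequality for [g], the projection of [k * x] onto [[-s, s]]. *)
have : 0 <= (g - p) * (k * x - g).
  rewrite /g; case: (clampP k x s0) => -[-> h].
  - by rewrite mulr_le0 //; lra.
  - by rewrite subrr mulr0.
  - by rewrite mulr_ge0 //; lra.
by have := sqr_ge0 (g - p); lra.
Qed.

(** The subgradient inequality at [y]: the affine minorant of slope [clamp k s y] touches the graph
    there. *)
Lemma huber_sub_le k s x y : 0 < k -> 0 < s ->
  huber k s y - huber k s x <= clamp k s y * (y - x).
Proof.
move=> k0 s0; have := huber_ge x k0 s0 (norm_clamp_le k y s0).
by rewrite [huber k s y]/huber; lra.
Qed.

(** The subgradient inequalities at [x] and [y] trap the remainder between 0 and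
    [(clamp k s y - clamp k s x) * (y - x)], which is at most [k * (y - x) ^+ 2]. *)
Lemma is_derive_huber k s x : 0 < k -> 0 < s ->
  is_derive (x : R^o) (1 : R^o) (huber k s : R^o -> R^o) (clamp k s x).
Proof.
move=> k0 s0; apply: (@is_derive1_quadratic_remainder _ _ _ _ k) => y.
have h1 := huber_sub_le x y k0 s0; have h2 := huber_sub_le y x k0 s0.
rewrite ger0_norm; last lra.
apply: le_trans (_ : (clamp k s y - clamp k s x) * (y - x) <= _); first lra.
apply: le_trans (ler_norm _) _.
rewrite normrM -[(y - x) ^+ 2]real_normK ?num_real // expr2 mulrA.
by rewrite ler_wpM2r // clamp_lipschitz.
Qed.

Lemma derive1_huber k s x : 0 < k -> 0 < s ->
  derive1 (huber k s : R^o -> R^o) x = clamp k s x.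
Proof.
by move=> k0 s0; rewrite derive1E; have [] := is_derive_huber x k0 s0.
Qed.

Lemma huber_lipschitz k s x y : 0 < k -> 0 < s ->
  `|huber k s x - huber k s y| <= s * `|x - y|.
Proof.
move=> k0 s0.
have bnd u v : huber k s u - huber k s v <= s * `|u - v|.
  apply: le_trans (huber_sub_le v u k0 s0) _.
  apply: le_trans (ler_norm _) _.
  by rewrite normrM ler_wpM2r // norm_clamp_le.
by rewrite ler_norml bnd andbT lerNl opprB distrC bnd.
Qed.

Lemma huber_ge0 k s x : 0 < k -> 0 < s -> 0 <= huber k s x.
Proof.
move=> k0 s0; have := @huber_ge k s x 0 k0 s0.
by rewrite normr0 mul0r expr0n mul0r subrr; apply; exact: ltW.
Qed.

Lemma huber0 k s : 0 < s -> huber k s 0 = 0.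
Proof.
move=> s0; rewrite /huber; have -> : clamp k s 0 = 0.
  by case: (clampP k 0 s0) => -[-> h]; lra.
by rewrite mul0r expr0n mul0r subrr.
Qed.

(* Conjugates turn infimal convolution into addition: [p^2/(2l) + p^2/(4l)] is
   [p^2/(2k)] with [k = 2l/3]. *)
Lemma moreau_huber l s : 0 < l -> 0 < s ->
  is_moreau l (huber l s) (huber (2 * l / 3) s).
Proof.
move=> l0 s0 x; set k := 2 * l / 3.
have k0 : 0 < k by rewrite /k; lra.
set p := clamp k s x.
have hubE : huber k s x = p * x - 3 * p ^+ 2 / (4 * l).
  by rewrite /huber -/p /k; field; lra.
split.
  (* The proximal point: it solves [clamp l s x' + 2 * l * (x' - x) = 0], with common slope [p]. *)
  exists (x - p / (2 * l)) => //.
  have -> : huber l s (x - p / (2 * l)) =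
      p * (x - p / (2 * l)) - p ^+ 2 / (2 * l).
    rewrite /huber.
    suff -> : clamp l s (x - p / (2 * l)) = p by [].
    have lE : l * (x - p / (2 * l)) = l * x - p / 2 by field; lra.
    have kE : k * x = 2 / 3 * (l * x) by rewrite /k; field.
    case: (clampP l (x - p / (2 * l)) s0) => -[-> ]; rewrite lE;
    by case: (clampP k x s0); rewrite kE -/p => -[pE ?]; rewrite pE; lra.
  rewrite real_normK ?num_real // hubE; field; lra.
move=> _ [x' _ <-]; rewrite real_normK ?num_real // hubE.
have := huber_ge x' l0 s0 (norm_clamp_le k x s0); rewrite -/p.
move=> h; rewrite -subr_ge0.
(* After Fenchel-Young at [x'] with slope [p], the remaining excess is exactly this square. *)
have : 0 <= l * (x' - x + p / (2 * l)) ^+ 2 by rewrite mulr_ge0 ?sqr_ge0 // ltW.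
have -> : l * (x' - x + p / (2 * l)) ^+ 2 =
  l * (x' - x) ^+ 2 + p * (x' - x) + p ^+ 2 / (4 * l) by field; lra.
have -> : 3 * p ^+ 2 / (4 * l) = p ^+ 2 / (2 * l) + p ^+ 2 / (4 * l).
  by field; lra.
lra.
Qed.

(** Here [D] is the gap. The branch [s * x - s ^+ 2 / (2 * k)] takes the value [D] at the given
    point, and the hypothesis places that point beyond the kink [s / k]. *)
Lemma gap_huber k s D : 0 < k -> 0 < s -> s ^+ 2 / (2 * k) <= D ->
  is_gap (huber k s) (D / s + s / (2 * k)) D.
Proof.
move=> k0 s0 sD; exists 0.
  split; first by exists 0; rewrite // huber0.
  by move=> _ [x _ <-]; exact: huber_ge0.
have sDk : s <= k * (D / s + s / (2 * k)).
  have -> : k * (D / s + s / (2 * k)) = k * D / s + s / 2 by field; lra.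
  suff : s / 2 <= k * D / s by lra.
  rewrite ler_pdivlMr //.
  move: sD; rewrite ler_pdivrMr; lra.
rewrite /huber; case: (clampP k (D / s + s / (2 * k)) s0) => -[-> h]; try lra.
  have -> : k * (D / s + s / (2 * k)) = s by lra.
  by field; lra.
by field; lra.
Qed.
End Huber.

(** * How far the iterates can travel in [x] *)

Section Trajectories.
Context {R : realType} {n : nat}.
Variables (Y : set 'rV[R]_n) (f : R -> 'rV[R]_n -> R) (eta_x eta_y s : R).
Hypothesis eta_x_ge0 : 0 <= eta_x.
Hypothesis grad_x_le : forall x y, `|grad_x f x y| <= s.

(** The increment is [-eta_x] times twice the current gradient minus the previous one, hence the
    factor 3. *)
Lemma ogda_x_ge (z0 : R * 'rV[R]_n) T :
  z0.1 - T%:R * (3 * s * eta_x) <= (ogda Y f eta_x eta_y z0 T).1.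
Proof.
elim: T => [|T IH]; first by rewrite mul0r subr0.
rewrite /ogda iterS; move: IH; rewrite /ogda.
case: (iter T _ _) => zp z /= IH; rewrite -natr1.
have := grad_x_le z.1 z.2; have := grad_x_le zp.1 zp.2.
rewrite !ler_norml => /andP[h1 _] /andP[_ h2].
have := eta_x_ge0; nra.
Qed.

(** A full step starts from [z], not from the midpoint, so it moves [x] by at most [s * eta_x]; the
    factor 3 gives both methods the same bound. *)
Lemma eg_x_ge (z0 : R * 'rV[R]_n) T :
  z0.1 - T%:R * (3 * s * eta_x) <= (eg Y f eta_x eta_y z0 T).1.
Proof.
elim: T => [|T IH]; first by rewrite mul0r subr0.
rewrite /eg iterS; move: IH; rewrite /eg.
move: (iter T _ _) => z /= IH; rewrite -natr1.
set gw := grad_x f _ _.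
have : `|gw| <= s by exact: grad_x_le.
rewrite ler_norml => /andP[h1 h2].
have := eta_x_ge0; nra.
Qed.
End Trajectories.

(** * The segment as a constraint set *)

Section Segment.
Context {R : realType}.
Implicit Types D : R.

Definition segment D : set 'rV[R]_1 := [set v | 0 <= v ord0 ord0 <= D].

Lemma euclid_norm1 (v : 'rV[R]_1) : euclid_norm v = `|v ord0 ord0|.
Proof. by rewrite /euclid_norm big_ord1 sqrtr_sqr. Qed.

Lemma segment_bounded D : bounded_set (segment D).
Proof.
rewrite /= /bounded_near; near=> M => v /= /andP[v0 vD].
have DM : D <= M by near: M; exact/nbhs_pinfty_ge/num_real.
have M0 : 0 <= M by near: M; exact/nbhs_pinfty_ge/num_real.
change (mx_norm v <= M); rewrite mx_normrE; apply/bigmax_leP; split=> // -[i j] _ /=.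
by rewrite !ord1 ger0_norm // (le_trans vD).
Unshelve. all: by end_near. Qed.

Lemma segment_closed D : closed (segment D).
Proof.
have -> : segment D = (fun v : 'rV[R]_1 => v ord0 ord0) @^-1` `[0, D]%classic.
  by apply/seteqP; split=> v /=; rewrite in_itv.
apply: closed_comp; last exact: itv_closed.
by move=> v _; exact: coord_continuous.
Qed.

Lemma segment_convex D : convex_set (segment D).
Proof.
move=> x y t; rewrite !inE /segment /= => /andP[x0 xD] /andP[y0 yD].
rewrite /conv /= !mxE.
have t0 : 0 <= t%:num by [].
have t1 : t%:num <= 1 by [].
by rewrite /unstable.onem; apply/andP; split; nra.
Qed.

Lemma segment_diameter D : 0 <= D -> diameter (segment D) = D.
Proof.
move=> D0; rewrite /diameter; set A := image _ _.
have ubA : ubound A D.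
  move=> _ [[u v] [/= /andP[u0 uD] /andP[v0 vD]] <-].
  by rewrite euclid_norm1 !mxE ler_norml; lra.
have AD : A D.
  exists (const_mx D, 0); first by split; rewrite /segment /= mxE; lra.
  by rewrite euclid_norm1 !mxE subr0 ger0_norm.
apply/eqP; rewrite eq_le; apply/andP; split.
  by apply: ge_sup => //; exists D.
by apply: ub_le_sup => //; exists D.
Qed.
End Segment.

(** * Objectives that do not depend on [y] *)

Section FirstVariableOnly.
Context {R : realType} {n : nat}.
Variables (Y : set 'rV[R]_n) (h : R -> R).

Lemma concave_in_y_cst : concave_in_y Y (fun x _ => h x).
Proof. by move=> x t y y' _ _; rewrite convmm. Qed.

Lemma is_primal_cst : Y !=set0 -> is_primal Y (fun x _ => h x) h.
Proof. by move=> [y Yy] x; split; [exists y | move=> _ [? _ <-]]. Qed.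

Lemma grad_y_cst x (y : 'rV[R]_n) : grad_y (fun x _ => h x) x y = 0.
Proof. by apply/rowP => i; rewrite !mxE derive_cst. Qed.

Lemma smooth_on_cst (l : R) :
  (forall x : R^o, derivable (h : R^o -> R^o) x 1) ->
  (forall x y, `|derive1 (h : R^o -> R^o) x - derive1 (h : R^o -> R^o) y|
     <= l * `|x - y|) ->
  smooth_on l Y (fun x _ => h x).
Proof.
move=> dh lip; split=> [x y _|x1 x2 y1 y2 _ _].
  apply: (@differentiable_comp _ _ _ _ fst (h : R^o -> R^o)).
    by apply: (linear_differentiable (f := fst)) => z; exact: cvg_fst.
  by apply/derivable1_diffP; exact: dh.
rewrite !grad_y_cst subrr.
have -> : euclid_norm (0 : 'rV[R]_n) = 0.
  by rewrite /euclid_norm big1 ?sqrtr0 // => i _; rewrite mxE expr0n.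
rewrite expr0n addr0 -[leLHS]real_normK ?num_real //.
apply: le_trans (_ : l ^+ 2 * (x1 - x2) ^+ 2 <= _).
  rewrite -[(x1 - x2) ^+ 2]real_normK ?num_real // -exprMn.
  (* The sign of [l * |x1 - x2|] is read off from [lip], since it bounds a norm. *)
  by apply: lerXn2r (lip _ _); rewrite ?nnegrE // (le_trans _ (lip _ _)).
by rewrite lerDl mulr_ge0 // sqr_ge0.
Qed.
End FirstVariableOnly.

(** * Step size bounds and the iteration lower bound *)

Lemma step_x_le (R : realType) (c1 l G D eps : R) : 0 <= c1 ->
  step_x c1 l G D eps <= c1 * (eps ^+ 4 / (D ^+ 2 * G ^+ 2 * l ^+ 3)).
Proof. by move=> c0; rewrite ler_wpM2l // !ge_min lexx !orbT. Qed.

Lemma step_x_ge0 (R : realType) (c1 l G D eps : R) :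
  0 <= c1 -> 0 < l -> 0 < G -> 0 < D -> 0 < eps -> 0 <= step_x c1 l G D eps.
Proof.
move=> c0 l0 G0 D0 e0; rewrite mulr_ge0 // !le_min.
by rewrite !divr_ge0 // ?mulr_ge0 // ?exprn_ge0 // ltW.
Qed.

Unset Implicit Arguments.
Set Strict Implicit.

Theorem theorem4p11 (R : realType) (c1 : R) (hc1 : 0 < c1) :
  exists2 c : R, 0 < c &
  forall l G D Delta : R, 0 < l -> 0 < G -> 0 < D -> 0 < Delta ->
  exists2 eps0 : R, 0 < eps0 &
  forall eps : R, 0 < eps -> eps < eps0 ->
  exists (n : nat) (Y : set 'rV[R]_n) (f : R -> 'rV[R]_n -> R)
         (x0 : R) (y0 : 'rV[R]_n) (Phi env : R -> R),
    [/\ [/\ bounded_set Y, closed Y, convex_set Y, diameter Y = D & Y y0],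
        [/\ lipschitz_in_x G Y f, smooth_on l Y f & concave_in_y Y f],
        [/\ is_primal Y f Phi, is_moreau l Phi env & is_gap env x0 Delta] &
        forall T : nat,
          let bound := c * (l ^+ 3 * G ^+ 2 * D ^+ 2 * Delta / eps ^+ 6) in
          let eta_x := step_x c1 l G D eps in
          let eta_y := step_y l in
          (`| derive1 env (ogda Y f eta_x eta_y (x0, y0) T).1 | <= eps ->
             bound <= T%:R) /\
          (`| derive1 env (eg Y f eta_x eta_y (x0, y0) T).1 | <= eps ->
             bound <= T%:R)].
Proof.
(* The 12 comes from [3 * s ^+ 2] with [s = 2 * eps]. *)
exists (12 * c1)^-1; first by rewrite invr_gt0 mulr_gt0.
move=> l G D Delta l0 G0 D0 Delta0.
(* The first bound gives [s <= G]. The other two give [eps ^+ 2 <= l * Delta / 3], which is the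
   condition [s ^+ 2 / (2 * k) <= Delta] of [gap_huber]. *)
exists (Num.min (G / 2) (Num.min 1 (l * Delta / 3))).
  by rewrite !lt_min ltr01 !divr_gt0 ?mulr_gt0.
move=> eps e0; rewrite !lt_min => /and3P[eG e1 eD].
pose s := 2 * eps; pose k := 2 * l / 3.
have s0 : 0 < s by rewrite /s; lra.
have k0 : 0 < k by rewrite /k; lra.
have Y0 : segment D 0 by rewrite /segment /= mxE lexx ltW.
pose f := fun (x : R) (_ : 'rV[R]_1) => huber l s x.
exists 1%N, (segment D), f, (Delta / s + s / (2 * k)), 0.
exists (huber l s), (huber k s).
have grad_f x y : grad_x f x y = clamp l s x by exact: derive1_huber.
have grad_f_le x y : `|grad_x f x y| <= s by rewrite grad_f norm_clamp_le.
split.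
- split => //; [exact: segment_bounded|exact: segment_closed|
    exact: segment_convex|exact/segment_diameter/ltW].
- split; last exact: concave_in_y_cst.
    move=> y _ [a b] _ /=; apply: le_trans (huber_lipschitz _ _ l0 s0) _.
    by rewrite ler_wpM2r // /s; lra.
  apply: smooth_on_cst => [x|x y].
    by have [] := is_derive_huber x l0 s0.
  by rewrite !derive1_huber // clamp_lipschitz.
- split; [by apply: is_primal_cst; exists 0|exact: moreau_huber|].
  apply: gap_huber => //; rewrite ler_pdivrMr; last lra.
  by rewrite /s /k; nra.
move=> T bound eta_x eta_y.
have eta0 : 0 <= eta_x by rewrite step_x_ge0 // ltW.
(* A small gradient of the envelope forces the iterate below
   [eps / k = s / (2 k)], at distance [Delta / s] from the start. *)
suff far x : Delta / s + s / (2 * k) - T%:R * (3 * s * eta_x) <= x ->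
    `|derive1 (huber k s : R^o -> R^o) x| <= eps -> bound <= T%:R.
  by split; apply: far; [exact: (ogda_x_ge _ _ _ grad_f_le (_, _))|
    exact: (eg_x_ge _ _ _ grad_f_le (_, _))].
move=> xge; rewrite derive1_huber // ler_norml => /andP[_ xle].
(* On the upper linear branch the derivative would be [s = 2 * eps], above [eps]. *)
have kx : k * x <= eps.
  have sE : s = 2 * eps by [].
  by case: (clampP k x s0) => -[gE h]; rewrite gE in xle; lra.
have xle' : x <= s / (2 * k) by rewrite ler_pdivlMr /s; lra.
have dist : Delta / s <= T%:R * (3 * s * eta_x) by lra.
have etale := @step_x_le _ c1 l G D eps (ltW hc1).
have : Delta / s <=
    T%:R * (3 * s * (c1 * (eps ^+ 4 / (D ^+ 2 * G ^+ 2 * l ^+ 3)))).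
  apply: le_trans dist _; rewrite ler_wpM2l // ler_wpM2l //; lra.
rewrite ler_pdivrMr // => {}dist.
(* The inverse of the factor multiplying [T] in [dist], so that the product leaves [T] alone. *)
have q0 : 0 < l ^+ 3 * G ^+ 2 * D ^+ 2 / (12 * c1 * eps ^+ 6).
  by rewrite divr_gt0 ?mulr_gt0 ?exprn_gt0.
rewrite /bound.
have -> : (12 * c1)^-1 * (l ^+ 3 * G ^+ 2 * D ^+ 2 * Delta / eps ^+ 6) =
  Delta * (l ^+ 3 * G ^+ 2 * D ^+ 2 / (12 * c1 * eps ^+ 6)).
  by field; apply/andP; split; lra.
apply: le_trans (ler_wpM2r (ltW q0) dist) _.
rewrite le_eqVlt; apply/orP; left; apply/eqP; rewrite /s; field.
by rewrite !gt_eqF.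
Qed.
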